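(* Let $H_1$ and $H_2$ be at least $3$-dimensional Hermitian spaces. Then any orthoisomorphism $f$ between $\mathbf P(H_1)$ and $\mathbf P(H_2)$ is induced by a quasiunitary map from $H_1$ to $H_2$; that is, there is a quasiunitary map $\phi\colon H_1\to H_2$ such that $f(\langle u\rangle)=\langle\phi(u)\rangle$ for all $u\in H_1$.
   Context: A sfield is a skew field (division ring). A $\ast$-sfield is a sfield $F$ with an involutory antiautomorphism $\ast \colon F \to F$. A Hermitian space over a $\ast$-sfield $F$ is a (left) linear space $H$ over $F$ with a map $(\cdot,\cdot)\colon H\times H\to F$ such that $(\alpha u+\beta v,w)=\alpha(u,w)+\beta(v,w)$, $(w,\alpha u+\beta v)=(w,u)\alpha^\ast+(w,v)\beta^\ast$, $(u,v)=(v,u)^\ast$ for all $u,v,w\in H$, $\alpha,\beta\in F$, and which is anisotropic: $(u,u)=0$ implies $u=0$. We write $u\perp v$ if $(u,v)=0$. The scalar $\ast$-sfields $F_1$ of $H_1$ and $F_2$ of $H_2$ may be different. Standing assumption: a Hermitian space contains at most countably many mutually orthogonal nonzero vectors. A map $\phi\colon H_1\to H_2$ is quasilinear with associated isomorphism $\sigma$ if it is additive and $\sigma\colon F_1\to F_2$ is an isomorphism of sfields with $\phi(\alpha u)=\alpha^\sigma\phi(u)$ for all $u\in H_1$, $\alpha\in F_1$ ($\alpha^\sigma$ is the image of $\alpha$ under $\sigma$). A bijection $\phi\colon H_1\to H_2$ is quasiunitary if it is quasilinear with associated isomorphism $\sigma$ and there is a $\lambda\in F_2\setminus\{0\}$ such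 that $(\phi(u),\phi(v))_2={(u,v)_1}^\sigma\,\lambda$ for all $u,v\in H_1$. An orthoset is a set $X$ with a symmetric binary relation $\perp$ and a constant $0$ such that $x\perp x$ if and only if $x=0$, and $0\perp x$ for all $x\in X$. An orthoisomorphism between orthosets $X$ and $Y$ is a bijection $f\colon X\to Y$ such that for all $x,y\in X$, $x\perp y$ if and only if $f(x)\perp f(y)$. For a Hermitian space $H$, $\mathbf P(H)=\{\langle u\rangle: u\in H\}$ is the set of at most one-dimensional subspaces of $H$ ($\langle u\rangle$ denotes the linear span of $u$), viewed as an orthoset with $\langle u\rangle\perp\langle v\rangle$ if $u\perp v$ and with the zero subspace $\{0\}$ as the constant $0$. *)

(* Defs.v *)
From HB Require Import structures.
From mathcomp Require Import all_boot all_order all_algebra.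
From mathcomp Require Import boolp classical_sets functions cardinality.

Set Implicit Arguments.
Unset Strict Implicit.
Unset Printing Implicit Defensive.

Import GRing.Theory.

Local Open Scope classical_set_scope.
Local Open Scope ring_scope.

(* MathComp has no structure between unitRingType and the commutative fieldType. *)
HB.mixin Record UnitRing_isSfield F of GRing.UnitRing F := {
  sfield_unit : forall x : F, x != 0 -> x \is a GRing.unit
}.

#[short(type="sfieldType")]
HB.structure Definition Sfield := {F of UnitRing_isSfield F & GRing.UnitRing F}.

(* starr 1 = 1 is not required: it follows from starrM and starrK. *)
HB.mixin Record Sfield_isStar F of Sfield F := {
  starr : F -> F;
  starrD : {morph starr : x y / x + y};
  starrM : forall x y : F, starr (x * y) = starr y * starr x;
  starrK : involutive starr
}.

#[short(type="starSfieldType")]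
HB.structure Definition StarSfield := {F of Sfield_isStar F & Sfield F}.

(* The forms of mathcomp's sesquilinear.v scale on the left in their second
   argument, which is the wrong side over a noncommutative F. *)
HB.mixin Record Lmodule_isHermitianSpace (F : starSfieldType) H
    of GRing.Lmodule F H := {
  hform : H -> H -> F;
  hformDZl : forall (a b : F) (u v w : H),
    hform (a *: u + b *: v) w = a * hform u w + b * hform v w;
  hformDZr : forall (a b : F) (u v w : H),
    hform w (a *: u + b *: v) = hform w u * starr a + hform w v * starr b;
  hform_star : forall u v : H, hform u v = starr (hform v u);
  hform_anisotropic : forall u : H, hform u u = 0 -> u = 0
}.

#[short(type="hermitianSpaceType")]
HB.structure Definition HermitianSpace (F : starSfieldType) :=
  {H of Lmodule_isHermitianSpace F H & GRing.Lmodule F H}.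

Definition countably_orthogonal (F : starSfieldType)
    (H : hermitianSpaceType F) : Prop :=
  forall A : set H,
    (forall u, A u -> u <> 0) ->
    (forall u v, A u -> A v -> u <> v -> hform u v = 0) ->
    countable A.

Definition lin_indep (F : starSfieldType) (H : lmodType F) (n : nat)
    (x : 'I_n -> H) : Prop :=
  forall a : 'I_n -> F, \sum_(i < n) a i *: x i = 0 -> forall i, a i = 0.

(* H may be infinite-dimensional. *)
Definition dim_ge (F : starSfieldType) (n : nat) (H : lmodType F) : Prop :=
  exists x : 'I_n -> H, lin_indep x.

(* No compatibility of sigma with the involutions is required. *)
Definition quasilinear_with (F1 F2 : starSfieldType)
    (H1 : hermitianSpaceType F1) (H2 : hermitianSpaceType F2)
    (sigma : {rmorphism F1 -> F2}) (phi : H1 -> H2) : Prop :=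
  [/\ bijective sigma,
      {morph phi : u v / u + v}
    & forall (a : F1) (u : H1), phi (a *: u) = sigma a *: phi u].

Definition quasiunitary (F1 F2 : starSfieldType)
    (H1 : hermitianSpaceType F1) (H2 : hermitianSpaceType F2)
    (phi : H1 -> H2) : Prop :=
  bijective phi /\
  exists sigma : {rmorphism F1 -> F2},
    quasilinear_with sigma phi /\
    exists2 lambda : F2, lambda != 0 &
      forall u v : H1, hform (phi u) (phi v) = sigma (hform u v) * lambda.

HB.mixin Record isOrthoset X := {
  operp : X -> X -> Prop;
  ozero : X;
  operp_sym : forall x y, operp x y -> operp y x;
  operpxx : forall x, operp x x <-> x = ozero;
  operp0x : forall x, operp ozero x
}.

#[short(type="orthosetType")]
HB.structure Definition Orthoset := {X of isOrthoset X}.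

Definition orthoisomorphism (X Y : orthosetType) (f : X -> Y) : Prop :=
  bijective f /\ forall x y : X, operp x y <-> operp (f x) (f y).

Definition line (F : starSfieldType) (H : lmodType F) (u : H) : set H :=
  [set a *: u | a in [set: F]].

(* The set P(H) of subspaces of dimension at most one. *)
Definition projective (F : starSfieldType) (H : hermitianSpaceType F) : Type :=
  {L : set H | exists u : H, L = line u}.

Definition pline (F : starSfieldType) (H : hermitianSpaceType F) (u : H) :
    projective H :=
  exist _ (line u) (ex_intro _ u erefl).

Section ProjectiveOrthoset.
Variables (F : starSfieldType) (H : hermitianSpaceType F).
Implicit Types (u v w : H) (L M : projective H).

Lemma line0 : line (0 : H) = [set 0].
Proof.
by apply/seteqP; split=> [x [a _ <-]|x ->]; [rewrite scaler0|exists 0; rewrite ?scaler0].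
Qed.

Definition pzero : projective H :=
  exist _ [set 0] (ex_intro _ (0 : H) (esym line0)).

Definition pperp L M : Prop :=
  exists u v, [/\ L = pline u, M = pline v & hform u v = 0].

Lemma projective_inj L M : sval L = sval M -> L = M.
Proof.
case: L M => [L hL] [M hM] /= eLM; subst M.
by rewrite (Prop_irrelevance hL hM).
Qed.

Lemma pline0 : pline (0 : H) = pzero.
Proof. by apply: projective_inj; rewrite /= line0. Qed.

Lemma pline_surj L : exists u, L = pline u.
Proof. by case: L => L [u e]; exists u; apply: projective_inj. Qed.

Lemma pline_eq u v : pline u = pline v -> exists a : F, v = a *: u.
Proof.
move=> /(congr1 sval) /= e; have : line v v by exists 1; rewrite ?scale1r.
by rewrite -e => -[a _ <-]; exists a.
Qed.

Lemma hformZl (a : F) u w : hform (a *: u) w = a * hform u w.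
Proof. by have := hformDZl a 0 u 0 w; rewrite !scale0r addr0 mul0r addr0. Qed.

Lemma starr0 : starr (0 : F) = 0.
Proof. by apply: (addrI (starr 0)); rewrite -starrD !addr0. Qed.

Lemma hform_sym0 u v : hform u v = 0 -> hform v u = 0.
Proof. by move=> uv; rewrite hform_star uv starr0. Qed.

Lemma pperp_pline u v : pperp (pline u) (pline v) <-> hform u v = 0.
Proof.
split=> [[x [y [/esym/pline_eq[a ->] /esym/pline_eq[b ->] xy]]]|uv].
  rewrite hformZl; have /hform_sym0 -> : hform (b *: y) x = 0.
    by rewrite hformZl (hform_sym0 xy) mulr0.
  by rewrite mulr0.
by exists u, v.
Qed.

Lemma pperp_sym L M : pperp L M -> pperp M L.
Proof. by move=> [u [v [-> -> uv]]]; exists v, u; split=> //; exact: hform_sym0. Qed.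

Lemma pperpxx L : pperp L L <-> L = pzero.
Proof.
have [u ->] := pline_surj L; rewrite pperp_pline -pline0; split.
  by move=> /hform_anisotropic ->.
move=> /esym/pline_eq[a ->].
by rewrite scaler0 -(scale0r (0 : H)) hformZl mul0r.
Qed.

Lemma pperp0x L : pperp pzero L.
Proof.
have [u ->] := pline_surj L; rewrite -pline0 pperp_pline.
by rewrite -(scale0r (0 : H)) hformZl mul0r.
Qed.

HB.instance Definition _ :=
  isOrthoset.Build (projective H) pperp_sym pperpxx pperp0x.

End ProjectiveOrthoset.

(* Main.v *)
(* Two-dimensional subspaces are orthoclosed, so an orthoisomorphism preserves
   the relation "w is in the span of u and v" and the fundamental theorem of
   projective geometry yields a semilinear bijection phi. For the latter, once
   representatives e', w' of the images of two independent vectors e, w are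
   chosen so that e' + w' represents the image of e + w, every further vector u
   has exactly one representative u' with e' + u' representing the image of
   e + u (or likewise with w), and u |-> u' is the required map.
   As v - ((v, u) / (u, u)) u is orthogonal to u, (phi v, phi u) is
   sigma (v, u) times a factor depending on u only. The factors of u1, u2 and
   u1 + u2 agree for independent u1, u2, so the factor is constant. *)
Require Import Defs.
From HB Require Import structures.
From mathcomp Require Import all_boot all_order all_algebra.
From mathcomp Require Import boolp classical_sets functions cardinality.

Set Implicit Arguments.
Unset Strict Implicit.
Unset Printing Implicit Defensive.

Import GRing.Theory.

(** * Spans and independence of two or three vectors over a skew field *)

Section Span.
Local Open Scope ring_scope.
Variables (F : sfieldType) (V : lmodType F).
Implicit Types (a b c d : F) (u v w x y z : V).

Lemma sfield_mulVr a : a != 0 -> a^-1 * a = 1.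
Proof. by move=> a0; rewrite mulVr // sfield_unit. Qed.

Lemma sfield_mulrV a : a != 0 -> a * a^-1 = 1.
Proof. by move=> a0; rewrite divrr // sfield_unit. Qed.

Lemma sfield_invr_neq0 a : a != 0 -> a^-1 != 0.
Proof.
move=> a0; apply/eqP => ai0; move: (sfield_mulVr a0).
by rewrite ai0 mul0r => /esym/eqP; rewrite oner_eq0.
Qed.

Lemma sfield_mulf_neq0 a b : a != 0 -> b != 0 -> a * b != 0.
Proof.
move=> a0; apply: contra_neq => ab0.
by rewrite -[b]mul1r -(sfield_mulVr a0) -mulrA ab0 mulr0.
Qed.

Lemma sfield_scalerK a u : a != 0 -> a^-1 *: (a *: u) = u.
Proof. by move=> a0; rewrite scalerA sfield_mulVr // scale1r. Qed.

Lemma sfield_scaler_eq0 a u : a *: u = 0 -> u <> 0 -> a = 0.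
Proof.
move=> au0 u0; apply/eqP/negPn/negP => a0; apply: u0.
by rewrite -(sfield_scalerK u a0) au0 scaler0.
Qed.

Lemma sfield_scaler_inj a b u : u <> 0 -> a *: u = b *: u -> a = b.
Proof.
move=> u0 /eqP; rewrite -subr_eq0 -scalerBl => /eqP/sfield_scaler_eq0 ab.
by apply/eqP; rewrite -subr_eq0 ab.
Qed.

(** Independence is not assumed: [in_span2 u u v] says that [v] is on the line of [u], so one
    relation covers collinearity as well as coplanarity. *)
Definition in_span2 u v w := exists a b, w = a *: u + b *: v.

Definition free2 u v := forall a b, a *: u + b *: v = 0 -> a = 0 /\ b = 0.

Definition free3 u v w :=
  forall a b c, a *: u + b *: v + c *: w = 0 -> [/\ a = 0, b = 0 & c = 0].

Lemma in_span2D u v x y :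
  in_span2 u v x -> in_span2 u v y -> in_span2 u v (x + y).
Proof.
move=> [a [b ->]] [c [d ->]]; exists (a + c), (b + d).
by rewrite !scalerDl addrACA.
Qed.

Lemma in_span2Z u v x a : in_span2 u v x -> in_span2 u v (a *: x).
Proof.
by move=> [b [c ->]]; exists (a * b), (a * c); rewrite scalerDr !scalerA.
Qed.

Lemma in_span2N u v x : in_span2 u v x -> in_span2 u v (- x).
Proof. by move=> /(@in_span2Z _ _ _ (-1)); rewrite scaleN1r. Qed.

Lemma in_span2l u v : in_span2 u v u.
Proof. by exists 1, 0; rewrite scale1r scale0r addr0. Qed.

Lemma in_span2r u v : in_span2 u v v.
Proof. by exists 0, 1; rewrite scale1r scale0r add0r. Qed.

Lemma in_span2_trans u v x y z :
  in_span2 u v x -> in_span2 u v y -> in_span2 x y z -> in_span2 u v z.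
Proof.
by move=> ux uy [a [b ->]]; apply: in_span2D; apply: in_span2Z.
Qed.

Lemma in_span2_scale u v w a b c : a != 0 -> b != 0 -> c != 0 ->
  in_span2 u v w <-> in_span2 (a *: u) (b *: v) (c *: w).
Proof.
have sub x y d e : d != 0 -> e != 0 ->
    in_span2 (d *: x) (e *: y) x /\ in_span2 (d *: x) (e *: y) y.
  move=> d0 e0; split.
    rewrite -[X in in_span2 _ _ X](sfield_scalerK x d0).
    by apply: in_span2Z; apply: in_span2l.
  rewrite -[X in in_span2 _ _ X](sfield_scalerK y e0).
  by apply: in_span2Z; apply: in_span2r.
move=> a0 b0 c0; split => [uvw|h].
  have [xu xv] := sub u v a b a0 b0.
  by apply: in_span2Z; apply: in_span2_trans uvw.
rewrite -(sfield_scalerK w c0); apply: in_span2Z; apply: in_span2_trans h.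
  by apply: in_span2Z; apply: in_span2l.
by apply: in_span2Z; apply: in_span2r.
Qed.

Lemma free2C u v : free2 u v -> free2 v u.
Proof. by move=> h a b; rewrite addrC => /h[]. Qed.

Lemma free2_neq0 u v : free2 u v -> u <> 0.
Proof.
move=> h u0; have [] := h 1 0; first by rewrite u0 scaler0 scale0r addr0.
by move/eqP; rewrite oner_eq0.
Qed.

Lemma free2P u v : free2 u v <-> u <> 0 /\ ~ in_span2 u u v.
Proof.
split => [h|[u0 h] a b].
  split; first exact: free2_neq0 h.
  move=> [a [b e]]; have [] := h (a + b) (-1).
    by rewrite e scaleN1r scalerDl addrN.
  by move=> _ /eqP; rewrite oppr_eq0 oner_eq0.
have [->|b0 /eqP] := eqVneq b 0.
  by rewrite scale0r addr0 => /sfield_scaler_eq0 ->.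
rewrite addrC addr_eq0 => /eqP e; case: h.
rewrite -(sfield_scalerK v b0) e; apply: in_span2Z; apply: in_span2N.
exact/in_span2Z/in_span2l.
Qed.

Lemma free3P u v w : free3 u v w <-> free2 u v /\ ~ in_span2 u v w.
Proof.
split => [h|[fuv h] a b c].
  split => [a b e|[a [b e]]].
    by have [] := h a b 0; rewrite ?scale0r ?addr0.
  have [] := h a b (-1); first by rewrite e scaleN1r addrN.
  by move=> _ _ /eqP; rewrite oppr_eq0 oner_eq0.
have [->|c0 /eqP] := eqVneq c 0.
  by rewrite scale0r addr0 => /fuv[-> ->].
rewrite addrC addr_eq0 => /eqP e; case: h.
rewrite -(sfield_scalerK w c0) e; apply/in_span2Z/in_span2N.
by exists a, b.
Qed.

Lemma free3_rot u v w : free3 u v w -> free3 v w u.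
Proof. by move=> h a b c; rewrite addrC addrA => /h[-> -> ->]. Qed.

Lemma free3_rotr u v w : free3 u v w -> free3 w u v.
Proof. by move=> /free3_rot/free3_rot. Qed.

Lemma free3_free2 u v w : free3 u v w -> free2 u v.
Proof. by case/free3P. Qed.

Lemma free3_free2r u v w : free3 u v w -> free2 u w.
Proof. by move=> /free3_rotr/free3_free2/free2C. Qed.

Lemma free3_free2D u v w : free3 u v w -> free2 u (v + w).
Proof. by move=> h a b; rewrite scalerDr addrA => /h[-> ->]. Qed.

Lemma free3_eq u v w a b c a' b' c' : free3 u v w ->
  a *: u + b *: v + c *: w = a' *: u + b' *: v + c' *: w ->
  [/\ a = a', b = b' & c = c'].
Proof.
move=> h e.
have [] := h (a - a') (b - b') (c - c').
  by rewrite !scalerBl (addrACA (a *: u)) (addrACA (a *: u + _)) -!opprD e subrr.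
by move=> /eqP + /eqP + /eqP; rewrite !subr_eq0 => /eqP-> /eqP-> /eqP->.
Qed.

Lemma free2_eq u v a b a' b' : free2 u v ->
  a *: u + b *: v = a' *: u + b' *: v -> a = a' /\ b = b'.
Proof.
move=> h /eqP; rewrite -subr_eq0 opprD addrACA -!scalerBl => /eqP/h[/eqP + /eqP].
by rewrite !subr_eq0 => /eqP-> /eqP->.
Qed.

(** Otherwise [w] is a multiple of both [u] and [v], and equating the two expressions gives a
    dependence. This lets a fixed free pair serve every nonzero vector. *)
Lemma free2_or u v w : free2 u v -> w <> 0 -> free2 u w \/ free2 v w.
Proof.
move=> fuv w0; apply: contrapT => /not_orP[nu nv].
have u0 := free2_neq0 fuv; have v0 := free2_neq0 (free2C fuv).
have [a [b e]] : in_span2 u u w by apply: contrapT => h; apply/nu/free2P.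
have [c [d e']] : in_span2 v v w by apply: contrapT => h; apply/nv/free2P.
have [] := fuv (a + b) (- (c + d)).
  by rewrite scaleNr !scalerDl -e -e' addrN.
by rewrite -scalerDl in e => ab0 _; apply: w0; rewrite e ab0 scale0r.
Qed.

Lemma free2_line u v w : free2 u v -> in_span2 w w u -> ~ in_span2 w w v.
Proof.
move=> fuv wu wv; have w0 : w <> 0.
  move=> w0; case: wu => a [b e]; apply: (free2_neq0 fuv).
  by rewrite e w0 !scaler0 addr0.
by case: (free2_or fuv w0) => /free2C/free2P[_].
Qed.

(** Exchange argument: eliminating one generator leaves two independent vectors on a single line. *)
Lemma free3_span2 x y z u v :
  free3 x y z -> in_span2 u v x -> in_span2 u v y -> ~ in_span2 u v z.
Proof.
(* As [p] involves [u], subtracting multiples of [p] removes [u] from [q] and [r]; the remainders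
   are on the line of [v] but still independent. *)
have pivot p q r a b : free3 p q r -> a != 0 -> p = a *: u + b *: v ->
    in_span2 u v q -> ~ in_span2 u v r.
  move=> fpqr a0 ep [c [d eq]] [c' [d' er]].
  have red s e k : s = e *: u + k *: v ->
      in_span2 v v (s - (e * a^-1) *: p).
    move=> ->; exists k, (- (e * a^-1 * b)).
    rewrite ep scalerDr !scalerA -(mulrA e) sfield_mulVr // mulr1 scaleNr.
    by rewrite opprD addrACA addrN add0r.
  apply: (free2_line _ (red _ _ _ eq) (red _ _ _ er)) => k l.
  rewrite !scalerBr !scalerA addrACA -opprD -scalerDl addrC -scaleNr addrA.
  by move=> /fpqr[].
move=> fxyz vx vy vz; move: (vx) (vy) => [a [b ex]] [c [d ey]].
have [a0|a0] := eqVneq a 0; last exact: pivot a0 ex vy vz.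
have [c0|c0] := eqVneq c 0; last exact: pivot (free3_rot fxyz) c0 ey vz vx.
(* Neither [x] nor [y] involves [u], so both are on the line of [v]. *)
apply: (free2_line (free3_free2 fxyz)) (_ : in_span2 v v x) (_ : in_span2 v v y).
  by exists b, 0; rewrite ex a0 !scale0r add0r addr0.
by exists d, 0; rewrite ey c0 !scale0r add0r addr0.
Qed.

End Span.

(** * Dimension at least three in terms of free triples *)

Section Dimension.
Local Open Scope ring_scope.
Variables (F : starSfieldType) (V : lmodType F).

Lemma dim_ge3P : dim_ge 3 V <-> exists u v w : V, free3 u v w.
Proof.
split=> [[x hx]|[u [v [w h]]]]; last first.
  exists (fun i : 'I_3 => nth 0 [:: u; v; w] i) => a.
  rewrite !big_ord_recl big_ord0 /= addr0 addrA => /h[a0 a1 a2] i.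
  case: i => [[|[|[|//]]] hi].
  - by rewrite -[RHS]a0; congr a; apply/val_inj.
  - by rewrite -[RHS]a1; congr a; apply/val_inj.
  - by rewrite -[RHS]a2; congr a; apply/val_inj.
exists (x 0), (x 1), (x (1 + 1)) => a b c e.
have := hx (fun i : 'I_3 => nth 0 [:: a; b; c] i).
rewrite !big_ord_recl big_ord0 /= addr0 addrA.
have -> : lift ord0 ord0 = 1 :> 'I_3 by apply/val_inj.
have -> : lift ord0 (lift ord0 ord0) = 1 + 1 :> 'I_3 by apply/val_inj.
by move=> /(_ e) h; have := h 0; have := h 1; have := h (1 + 1).
Qed.

(** Otherwise the span of [u] and [v] is the whole space and contains a free triple. *)
Lemma dim_ge3_free3 (u v : V) : dim_ge 3 V -> free2 u v -> exists w, free3 u v w.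
Proof.
move=> /dim_ge3P[x [y [z fxyz]]] fuv; apply: contrapT => h.
have uv w : in_span2 u v w.
  by apply: contrapT => nw; apply: h; exists w; apply/free3P.
exact: (free3_span2 fxyz (uv x) (uv y) (uv z)).
Qed.

End Dimension.

Lemma inj_surj_bij (S T : Type) (h : S -> T) :
  injective h -> (forall y, exists x, h x = y) -> bijective h.
Proof.
by move=> hI /choice[k hK]; exists k => // x; apply: hI; rewrite hK.
Qed.

Definition rmorphism_of (R S : nzRingType) (s : R -> S)
    (sB : zmod_morphism s) (sM : monoid_morphism s) : {rmorphism R -> S} :=
  HB.pack s (GRing.isZmodMorphism.Build R S s sB)
    (GRing.isMonoidMorphism.Build R S s sM).

(** * The fundamental theorem of projective geometry *)

Section Fundamental.
Local Open Scope ring_scope.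
Variables (F1 F2 : sfieldType) (V1 : lmodType F1) (V2 : lmodType F2).
Variable g : V1 -> V2.
Hypothesis g0 : g 0 = 0.
Hypothesis g_span2 :
  forall u v w, in_span2 u v w <-> in_span2 (g u) (g v) (g w).
Hypothesis g_surj : forall y, exists u (a : F2), a != 0 /\ y = a *: g u.
Hypothesis free3_ex : forall u v : V1, free2 u v -> exists w, free3 u v w.
Hypothesis free2_ex : exists u v : V1, free2 u v.

Implicit Types (u v w : V1) (x y z : V2).

(** [x] is a representative of the image of the line of [u]; [g] is just one choice of
    representatives. *)
Definition spans u x := exists2 a, a != 0 & x = a *: g u.

(** The representatives [x] and [y] are scaled consistently: for independent [u] and [v], each
    determines the other. *)
Definition compat u v x y := [/\ spans u x, spans v y & spans (u + v) (x + y)].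

Lemma g_eq0 u : g u = 0 -> u = 0.
Proof.
move=> gu0; have [_] := g_span2 0 0 u; rewrite g0 gu0 => h.
have [|a [b ->]] := h; last by rewrite !scaler0 addr0.
by exists 0, 0; rewrite !scaler0 addr0.
Qed.

Lemma spans_neq0 u x : spans u x -> u <> 0 -> x <> 0.
Proof.
move=> [a a0 ->] u0 ax0; apply/u0/g_eq0.
by rewrite -(sfield_scalerK (g u) a0) ax0 scaler0.
Qed.

Lemma spans_uniq u x y : spans u x -> spans u y -> exists a, y = a *: x.
Proof.
move=> [a a0 ->] [b b0 ->]; exists (b * a^-1).
by rewrite scalerA -mulrA sfield_mulVr // mulr1.
Qed.

Lemma spans_line u v x y : spans u x -> spans v y ->
  (exists a, y = a *: x) -> exists a, v = a *: u.
Proof.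
move=> [a a0 ->] [b b0 ->] [c e]; have [_ h] := g_span2 u u v.
have [|d [d' ->]] := h; last by exists (d + d'); rewrite scalerDl.
exists (b^-1 * c * a), 0.
by rewrite scale0r addr0 -!scalerA -e sfield_scalerK.
Qed.

Lemma spans_span2 u v w x y z : spans u x -> spans v y -> spans w z ->
  in_span2 u v w <-> in_span2 x y z.
Proof.
move=> [a a0 ->] [b b0 ->] [c c0 ->]; rewrite g_span2.
exact: in_span2_scale.
Qed.

Lemma spans_free2 u v x y : spans u x -> spans v y -> free2 u v -> free2 x y.
Proof.
move=> ux vy /free2P[u0 uv]; apply/free2P; split; first exact: spans_neq0 u0.
by rewrite -(spans_span2 ux ux vy).
Qed.

Lemma spans_free3 u v w x y z : spans u x -> spans v y -> spans w z ->
  free3 u v w -> free3 x y z.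
Proof.
move=> ux vy wz /free3P[uv uvw]; apply/free3P; split.
  exact: spans_free2 uv.
by rewrite -(spans_span2 ux vy wz).
Qed.

Lemma spans_g u : spans u (g u).
Proof. by exists 1; rewrite ?oner_eq0 ?scale1r. Qed.

Lemma compatC u v x y : compat u v x y -> compat v u y x.
Proof. by move=> [ux vy uvxy]; split; rewrite // (addrC v) (addrC y). Qed.

(** The image of [p + q] is in the span of [p'] and [g q] but on neither of their lines, so both
    coefficients are nonzero and can be normalized. *)
Lemma compat_ex p q p' : free2 p q -> spans p p' -> exists q', compat p q p' q'.
Proof.
move=> fpq pp'.
have nz u v a y : free2 u v -> spans v y -> g (u + v) <> a *: y.
  move=> fuv vy e; have [|b e'] := spans_line vy (spans_g (u + v)).
    by exists a.
  have [] := fuv 1 (1 - b); last by move/eqP; rewrite oner_eq0.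
  by rewrite scale1r scalerBl scale1r -e' addrA subrr.
have : in_span2 p q (p + q) by exact: in_span2D (in_span2l _ _) (in_span2r _ _).
rewrite (spans_span2 pp' (spans_g q) (spans_g (p + q))) => -[a [b e]].
have a0 : a != 0.
  apply/eqP => a0; apply: (nz _ _ b _ fpq (spans_g q)).
  by rewrite e a0 scale0r add0r.
have b0 : b != 0.
  apply/eqP => b0; apply: (nz _ _ a _ (free2C fpq) pp').
  by rewrite addrC e b0 scale0r addr0.
exists ((a^-1 * b) *: g q); split => //.
  by exists (a^-1 * b) => //; rewrite sfield_mulf_neq0 // sfield_invr_neq0.
exists a^-1; first exact: sfield_invr_neq0.
by rewrite e scalerDr sfield_scalerK // scalerA.
Qed.

(** [p' + q''] is a multiple of [p' + q'], and comparing the coefficients of [p'] shows that the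
    factor is 1. *)
Lemma compat_uniq p q p' q' q'' :
  free2 p q -> compat p q p' q' -> compat p q p' q'' -> q' = q''.
Proof.
move=> fpq [pp' qq' s] [_ qq'' t].
have [a ea] := spans_uniq qq' qq''; have [b] := spans_uniq s t.
rewrite ea scalerDr -{1}[p']scale1r => /(free2_eq (spans_free2 pp' qq' fpq)).
by move=> [<- ->]; rewrite scale1r.
Qed.

(* <p+q+r> is the meet of <p+q> + <r> and <p+r> + <q>, and <q+r> is the meet
   of <q> + <r> and <p> + <p+q+r>. *)
Lemma compat_trans p q r p' q' r' : free3 p q r ->
  compat p q p' q' -> compat p r p' r' ->
  compat q r q' r' /\ compat p (q + r) p' (q' + r').
Proof.
move=> f [pp' qq' pq] [_ rr' pr].
have f' := spans_free3 pp' qq' rr' f.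
have sum3 : spans (p + (q + r)) (p' + (q' + r')).
  have [a [b ea]] : in_span2 (p' + q') r' (g (p + (q + r))).
    rewrite -(spans_span2 pq rr' (spans_g _)).
    by exists 1, 1; rewrite !scale1r addrA.
  have [c [d ec]] : in_span2 (p' + r') q' (g (p + (q + r))).
    rewrite -(spans_span2 pr qq' (spans_g _)).
    by exists 1, 1; rewrite !scale1r -addrA (addrC q).
  have [ac _ eb] : [/\ a = c, a = d & b = c].
    apply: (free3_eq f').
    by rewrite -scalerDr -ea ec scalerDr addrAC.
  have e : g (p + (q + r)) = a *: (p' + (q' + r')).
    by rewrite ea eb -ac addrA -scalerDr.
  have a0 : a != 0.
    apply/eqP => a0; move: e; rewrite a0 scale0r => /g_eq0.
    rewrite addrA => e'; have [] := f 1 1 1; first by rewrite !scale1r.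
    by move/eqP; rewrite oner_eq0.
  by exists a^-1; rewrite ?sfield_invr_neq0 // e sfield_scalerK.
suff qr : spans (q + r) (q' + r').
  split; split => //.
have [a [b ea]] : in_span2 q' r' (g (q + r)).
  rewrite -(spans_span2 qq' rr' (spans_g _)).
  by exists 1, 1; rewrite !scale1r.
have [c [d ec]] : in_span2 p' (p' + (q' + r')) (g (q + r)).
  rewrite -(spans_span2 pp' sum3 (spans_g _)).
  by exists (-1), 1; rewrite scale1r scaleN1r addrA addNr add0r.
have [_ ad bd] : [/\ 0 = c + d, a = d & b = d].
  apply: (free3_eq f').
  by rewrite scale0r add0r -ea ec !scalerDr scalerDl !addrA.
have e : g (q + r) = a *: (q' + r') by rewrite ea bd -ad scalerDr.
have a0 : a != 0.
  apply/eqP => a0; move: e; rewrite a0 scale0r => /g_eq0 e'.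
  have [] := f 0 1 1; first by rewrite scale0r !scale1r add0r.
  by move=> _ /eqP; rewrite oner_eq0.
by exists a^-1; rewrite ?sfield_invr_neq0 // e sfield_scalerK.
Qed.

(** The representatives of [u] prescribed by [p] and by [q] agree wherever both exist, so a single
    [x] serves for both. *)
Lemma compat_line_ext p q p' q' : free2 p q -> compat p q p' q' ->
  forall u, exists x,
    (free2 p u -> compat p u p' x) /\ (free2 q u -> compat q u q' x).
Proof.
move=> fpq cpq u.
have [fpu|npu] := pselect (free2 p u); last first.
  have [fqu|nqu] := pselect (free2 q u); last by exists 0.
  have [_ qq' _] := cpq.
  by have [x qx] := compat_ex fqu qq'; exists x.
have [pp' qq' _] := cpq.
have [x px] := compat_ex fpu pp'; exists x; split => // fqu.
have [fpqu|npqu] := pselect (free3 p q u).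
  by have [] := compat_trans fpqu cpq px.
have pqu : in_span2 p q u.
  by apply: contrapT => h; apply/npqu/free3P.
(* [u] is in the plane of [p] and [q]. A vector [r] off the plane, with representative [y], moves
   the question to [u + r]: both [x + y] and [x' + y] turn out compatible with [q'], hence they are
   equal. *)
have [r fpqr] := free3_ex fpq.
have [_ pqr] := (free3P _ _ _).1 fpqr.
have fpur : free3 p u r.
  apply/free3P; split => // h; apply: pqr.
  exact: in_span2_trans (in_span2l _ _) pqu h.
have fqur : free3 q u r.
  apply/free3P; split => // h; apply: pqr.
  exact: in_span2_trans (in_span2r _ _) pqu h.
have fpqur : free3 p q (u + r).
  apply/free3P; split => // h; apply: pqr.
  by rewrite -[r](addKr u); apply: in_span2D h; apply: in_span2N.
have fpr := free3_free2r fpqr.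
have [y py] := compat_ex fpr pp'.
have [qy _] := compat_trans fpqr cpq py.
have [_ pxy] := compat_trans fpur px py.
have [qxy _] := compat_trans fpqur cpq pxy.
have [x' qx'] := compat_ex fqu qq'.
have [_ qx'y] := compat_trans fqur qx' qy.
by rewrite (addIr _ (compat_uniq (free3_free2D fqur) qxy qx'y)).
Qed.

(** If [p] is an anchor off the plane of [u] and [v], then [compat_trans] makes [phi u] and [phi v]
    compatible. *)
Definition anchor (phi : V1 -> V2) p :=
  spans p (phi p) /\ forall u, free2 p u -> compat p u (phi p) (phi u).

Lemma compat_map_ex : exists2 phi, phi 0 = 0 &
  forall u v, free2 u v -> compat u v (phi u) (phi v).
Proof.
have [e [w few]] := free2_ex.
have [w' cew] := compat_ex few (spans_g e).
have /choice[phi0 hphi0] := compat_line_ext few cew.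
have [ew0 _] := hphi0 w; have [_ we0] := hphi0 e.
have phiw : phi0 w = w' by exact: compat_uniq (ew0 few) cew.
have phie : phi0 e = g e.
  exact: compat_uniq (free2C few) (we0 (free2C few)) (compatC cew).
suff h : forall u v, free2 u v -> compat u v (phi0 u) (phi0 v).
  (* The choice of [phi0] leaves its value at 0 arbitrary, as 0 belongs to no free pair. *)
  exists (fun u => if u == 0 then 0 else phi0 u); first by rewrite eqxx.
  move=> u v fuv; have /eqP/negPf-> := free2_neq0 fuv.
  by have /eqP/negPf-> := free2_neq0 (free2C fuv); exact: h.
have ae : anchor phi0 e.
  split=> [|u feu]; first by rewrite phie; exact: spans_g.
  by rewrite phie; apply: (hphi0 u).1.
have aw : anchor phi0 w.
  split=> [|u fwu]; first by rewrite phiw; case: cew.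
  by rewrite phiw; apply: (hphi0 u).2.
(* The planes of [e], [z] and of [w], [z] meet in the line of [z]. As [u] is off that line, [e] or
   [w] completes [z], [u] to a free triple. *)
have az (z : V1) : free3 e w z -> anchor phi0 z.
  move=> fewz; have few' := free3_free2 fewz.
  have fez : free2 e z := free3_free2r fewz.
  have fwz : free2 w z := free3_free2 (free3_rot fewz).
  split=> [|u fzu]; first by have [_ /(_ _ fez)[]] := ae.
  have [fezu|nezu] := pselect (free3 e z u).
    by have [] := compat_trans fezu (ae.2 _ fez) (ae.2 _ (free3_free2r fezu)).
  have [fwzu|nwzu] := pselect (free3 w z u).
    by have [] := compat_trans fwzu (aw.2 _ fwz) (aw.2 _ (free3_free2r fwzu)).
  have [a [b eu]] : in_span2 e z u by apply: contrapT => h; apply/nezu/free3P.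
  have [c [d eu']] : in_span2 w z u by apply: contrapT => h; apply/nwzu/free3P.
  have [a0 _ _] : [/\ a = 0, 0 = c & b = d].
    by apply: (free3_eq fewz); rewrite !scale0r addr0 add0r -eu eu'.
  have [_ []] := (free2P _ _).1 fzu.
  by exists b, 0; rewrite eu a0 !scale0r add0r addr0.
move=> u v fuv.
(* If the plane of [u] and [v] contains both [e] and [w], then any [z] off this plane is also off
   the plane of [e] and [w], hence an anchor. *)
have [p [ap fpuv]] : exists p, anchor phi0 p /\ free3 p u v.
  have [/free3_rotr fe|ne] := pselect (free3 u v e); first by exists e.
  have [/free3_rotr fw|nw] := pselect (free3 u v w); first by exists w.
  have [z fuvz] := free3_ex fuv; exists z; split; last exact: free3_rotr fuvz.
  apply: az; apply/free3P; split => // ewz.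
  have [_ []] := (free3P _ _ _).1 fuvz; apply: in_span2_trans ewz.
    by apply: contrapT => h; apply/ne/free3P.
  by apply: contrapT => h; apply/nw/free3P.
have fpu := free3_free2 fpuv.
have fpv := free3_free2r fpuv.
by have [] := compat_trans fpuv (ap.2 _ fpu) (ap.2 _ fpv).
Qed.

(** * Additivity and semilinearity of a compatible choice of representatives *)

Section CompatMap.
Variable phi : V1 -> V2.
Hypothesis phi0 : phi 0 = 0.
Hypothesis phiP : forall u v, free2 u v -> compat u v (phi u) (phi v).

Lemma free2_vec u : u <> 0 -> exists v, free2 u v.
Proof.
have [e [w few]] := free2_ex.
by move=> /(free2_or few)[/free2C|/free2C] h; [exists e|exists w].
Qed.

Lemma phi_spans u : spans u (phi u).
Proof.
have [->|/eqP/free2_vec[v /phiP[]//]] := eqVneq u 0.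
by rewrite phi0 -g0; exact: spans_g.
Qed.

(** Seen from a third independent vector [w], both sides are the representative of [u + v]
    compatible with [phi w]. *)
Lemma phiD_free u v : free2 u v -> phi (u + v) = phi u + phi v.
Proof.
move=> fuv; have [w /free3_rotr fwuv] := free3_ex fuv.
have fwu := free3_free2 fwuv.
have fwv := free3_free2r fwuv.
have [_ h] := compat_trans fwuv (phiP fwu) (phiP fwv).
have fwuv' := free3_free2D fwuv.
exact: compat_uniq fwuv' (phiP fwuv') h.
Qed.

Lemma phiD : {morph phi : u v / u + v}.
Proof.
move=> u v; have [->|/eqP u0] := eqVneq u 0; first by rewrite phi0 !add0r.
have [->|/eqP v0] := eqVneq v 0; first by rewrite phi0 !addr0.
have [/phiD_free//|nuv] := pselect (free2 u v).
have [a ev] : exists a, v = a *: u.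
  apply: contrapT => h; apply/nuv/free2P; split=> // -[a [b e]].
  by apply: h; exists (a + b); rewrite scalerDl.
(* For collinear [u] and [v], evaluate [phi (u + v + w)] with [w] off their line: all sums taken are
   then of free pairs, unless [u + v = 0], and [phi w] cancels. *)
have [w fuw] := free2_vec u0.
have fvw : free2 v w.
  move=> b c; rewrite ev scalerA => /fuw[ba ->]; split=> //.
  by apply: sfield_scaler_eq0 v0; rewrite ev scalerA ba scale0r.
have fu_vw : free2 u (v + w).
  move=> b c; rewrite ev scalerDr addrA scalerA -scalerDl => /fuw[+ c0].
  by rewrite c0 mul0r addr0.
apply: (addIr (phi w)); rewrite -addrA -(phiD_free fvw) -(phiD_free fu_vw).
have [uv0|/eqP uv0] := eqVneq (u + v) 0.
  by rewrite addrA uv0 phi0 !add0r.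
rewrite addrA [RHS]phiD_free // => b c.
rewrite {1}ev -{1}[u]scale1r -scalerDl scalerA => /fuw[ba ->]; split=> //.
apply: sfield_scaler_eq0 uv0.
by rewrite {1}ev -{1}[u]scale1r -scalerDl scalerA ba scale0r.
Qed.

Lemma phiB u v : phi (u - v) = phi u - phi v.
Proof. by apply: (addIr (phi v)); rewrite -phiD !subrK. Qed.

Lemma phi_inj : injective phi.
Proof.
move=> u v e; apply/eqP; rewrite -subr_eq0; apply/eqP; apply: contrapT => n0.
by apply: (spans_neq0 (phi_spans (u - v)) n0); rewrite phiB e subrr.
Qed.

Lemma phi_free2 u v : free2 u v -> free2 (phi u) (phi v).
Proof. exact: spans_free2 (phi_spans u) (phi_spans v). Qed.

Lemma phi_scale u a : exists b, phi (a *: u) = b *: phi u.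
Proof.
have : in_span2 u u (a *: u) by exists a, 0; rewrite scale0r addr0.
rewrite (spans_span2 (phi_spans u) (phi_spans u) (phi_spans _)).
by move=> [b [c ->]]; exists (b + c); rewrite scalerDl.
Qed.

(** Expand [phi (a *: (u + v))] before and after distributing [a] and compare coefficients. *)
Lemma phi_scale_transfer u v a b : free2 u v ->
  phi (a *: u) = b *: phi u -> phi (a *: v) = b *: phi v.
Proof.
move=> fuv eb; have [c ec] := phi_scale v a; have [d] := phi_scale (u + v) a.
rewrite scalerDr !phiD scalerDr eb ec => /(free2_eq (phi_free2 fuv))[-> ->].
by [].
Qed.

Lemma phi_semilinear : exists s : F1 -> F2,
  forall a u, phi (a *: u) = s a *: phi u.
Proof.
have [e [w few]] := free2_ex.
(* [s] is read off on the line of [e] and carried to any other vector, through [w] if that vector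
   depends on [e]. *)
have /choice[s hs] := phi_scale e; exists s => a u.
have [->|/eqP u0] := eqVneq u 0; first by rewrite scaler0 phi0 scaler0.
have [feu|fwu] := free2_or few u0; first exact: phi_scale_transfer (hs a).
exact: phi_scale_transfer fwu (phi_scale_transfer few (hs a)).
Qed.

Lemma phi_sigma : exists2 sigma : {rmorphism F1 -> F2}, bijective sigma &
  forall a u, phi (a *: u) = sigma a *: phi u.
Proof.
have [s hs] := phi_semilinear; have [e [w few]] := free2_ex.
have e0 := free2_neq0 few.
have pe0 : phi e <> 0 := spans_neq0 (phi_spans e) e0.
have sB : zmod_morphism s.
  move=> a b; apply: (sfield_scaler_inj pe0).
  by rewrite scalerBl -!hs -phiB scalerBl.
have sM : monoid_morphism s.
  split=> [|a b]; apply: (sfield_scaler_inj pe0).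
    by rewrite -hs !scale1r.
  by rewrite -scalerA -!hs scalerA.
pose sigma := rmorphism_of sB sM; exists sigma; last exact: hs.
have {}hs a u : phi (a *: u) = sigma a *: phi u by exact: hs.
apply: inj_surj_bij => [a b eab|b].
  by apply: (sfield_scaler_inj e0); apply: phi_inj; rewrite !hs eab.
(* Surjectivity of [sigma]: if [x = k *: e + l *: w] represents the preimage of the line of
   [phi e + b *: phi w], then [b] is the image of [k^-1 * l]. *)
have [x [a [a0 ex]]] := g_surj (phi e + b *: phi w).
have sx : spans x (phi e + b *: phi w) by exists a.
have fpew := phi_free2 few.
have x0 : x <> 0.
  move=> x0; have [] := fpew 1 b; last by move/eqP; rewrite oner_eq0.
  by rewrite scale1r ex x0 g0 scaler0.
have [k [l exkl]] : in_span2 e w x.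
  rewrite (spans_span2 (phi_spans e) (phi_spans w) sx).
  by exists 1, b; rewrite scale1r.
have [c] := spans_uniq sx (phi_spans x).
rewrite {1}exkl phiD !hs scalerDr scalerA => /(free2_eq fpew)[sk sl].
have k0 : k != 0.
  apply/eqP => k0; apply: x0; rewrite exkl k0.
  have l0 : sigma l = 0 by rewrite sl -sk k0 rmorph0 mul0r.
  apply: phi_inj.
  by rewrite scale0r add0r hs l0 scale0r phi0.
exists (k^-1 * l); rewrite rmorphM sl mulrA -sk -rmorphM sfield_mulVr //.
by rewrite rmorph1 mul1r.
Qed.

End CompatMap.

Theorem fundamental_projective_geometry :
  exists (phi : V1 -> V2) (sigma : {rmorphism F1 -> F2}),
    [/\ bijective phi, bijective sigma, {morph phi : u v / u + v},
        forall a u, phi (a *: u) = sigma a *: phi u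
      & forall u, exists2 a, a != 0 & phi u = a *: g u].
Proof.
have [phi phi0 phiP] := compat_map_ex.
have [sigma bij_sigma phiZ] := phi_sigma phi0 phiP.
exists phi, sigma; split=> //; last exact: phi_spans.
- apply: inj_surj_bij => [|y]; first exact: phi_inj.
  have [u [a [a0 ey]]] := g_surj y; have sy : spans u y by exists a.
  have [b ->] := spans_uniq (phi_spans phi0 phiP u) sy.
  have [tau _ tauK] := bij_sigma; exists (tau b *: u).
  by rewrite phiZ tauK.
- exact: phiD.
Qed.

End Fundamental.

(** * Orthogonality and spans in a Hermitian space *)

Section Hermitian.
Local Open Scope ring_scope.
Variables (F : starSfieldType) (H : hermitianSpaceType F).
Implicit Types (a b : F) (u v w x : H).

Lemma hformDl u v w : hform (u + v) w = hform u w + hform v w.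
Proof. by have := hformDZl 1 1 u v w; rewrite !scale1r !mul1r. Qed.

Lemma hformBl u v w : hform (u - v) w = hform u w - hform v w.
Proof. by apply: (addIr (hform v w)); rewrite -hformDl !subrK. Qed.

Lemma hformDr u v w : hform w (u + v) = hform w u + hform w v.
Proof. by rewrite !(hform_star w) -starrD hformDl. Qed.

Lemma hformC0 u v : hform u v = 0 <-> hform v u = 0.
Proof. by split; exact: hform_sym0. Qed.

Lemma hform_neq0 u : u <> 0 -> hform u u != 0.
Proof. by move=> u0; apply/eqP => /hform_anisotropic. Qed.

(** The orthogonal projection of [v] onto the line of [u]. *)
Definition hproj u v := (hform v u * (hform u u)^-1) *: u.

Lemma hform_proj u v : u <> 0 -> hform (v - hproj u v) u = 0.
Proof.
move=> u0; rewrite hformBl hformZl -mulrA sfield_mulVr ?hform_neq0 //.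
by rewrite mulr1 subrr.
Qed.

Lemma hform_span2 u v w x :
  in_span2 u v w -> hform u x = 0 -> hform v x = 0 -> hform w x = 0.
Proof.
by move=> [a [b ->]] ux vx; rewrite hformDl !hformZl ux vx !mulr0 addr0.
Qed.

(** Remove from [v] and [w] their parts along [u], giving [v'] and [w'], then from [w'] its part
    along [v']. Zero vectors are allowed, so [u] and [v] may be dependent. *)
Lemma perp_exists u v w : exists x,
  [/\ hform x u = 0, hform x v = 0 & in_span2 u v (w - x)].
Proof.
have line p q : exists x, hform x p = 0 /\ exists a, q - x = a *: p.
  have [->|/eqP p0] := eqVneq p 0.
    exists q; split; first by apply/hformC0; rewrite -(scale0r q) hformZl mul0r.
    by exists 0; rewrite scale0r subrr.
  exists (q - hproj p q); split; first exact: hform_proj.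
  by rewrite opprB addrC subrK; eexists.
have [v' [v'u [a ev]]] := line u v.
have [w' [w'u [b ew]]] := line u w.
have [x [xv' [c ex]]] := line v' w'.
have xu : hform x u = 0.
  have -> : x = w' - c *: v' by rewrite -ex opprB addrC subrK.
  by rewrite hformBl hformZl w'u v'u mulr0 subrr.
have e : v = a *: u + v' by rewrite -ev subrK.
exists x; split=> //.
  by apply/hformC0; rewrite e hformDl hformZl !((hformC0 _ x).2) // mulr0 addr0.
rewrite -[w](subrK w') ew -addrA ex.
have -> : v' = v - a *: u by rewrite -ev opprB addrC subrK.
apply: in_span2D; first exact/in_span2Z/in_span2l.
apply: in_span2Z; apply: in_span2D; first exact: in_span2r.
exact/in_span2N/in_span2Z/in_span2l.
Qed.

(* Two-dimensional subspaces are orthoclosed, by Gram-Schmidt. *)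
Lemma in_span2_perp u v w : in_span2 u v w <->
  forall x, hform u x = 0 -> hform v x = 0 -> hform w x = 0.
Proof.
split=> [uvw x|h]; first exact: hform_span2.
have [x [/hformC0 ux /hformC0 vx uvwx]] := perp_exists u v w.
have wx := h x ux vx; have wxx := hform_span2 uvwx ux vx.
suff x0 : x = 0 by rewrite -[w]subr0 -x0.
apply: hform_anisotropic; move: wxx.
by rewrite hformBl wx sub0r => /eqP; rewrite oppr_eq0 => /eqP.
Qed.

Lemma pline_scale a u : a != 0 -> pline (a *: u) = pline u.
Proof.
move=> a0; apply/projective_inj/seteqP; split=> x [b _ <-] /=.
  by exists (b * a); rewrite ?scalerA.
by exists (b * a^-1) => //; rewrite -scalerA sfield_scalerK.
Qed.

End Hermitian.

Lemma rmorph_sfield_neq0 (F1 F2 : sfieldType) (s : {rmorphism F1 -> F2}) a :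
  a != 0%R -> s a != 0%R.
Proof.
move=> a0; apply/eqP => sa0; have /eqP := rmorph1 s.
by rewrite -(sfield_mulrV a0) rmorphM sa0 mul0r eq_sym oner_eq0.
Qed.

(** * A semilinear map preserving orthogonality multiplies the form by a constant *)

Section Quasiunitary.
Local Open Scope ring_scope.
Variables (F1 F2 : starSfieldType).
Variables (H1 : hermitianSpaceType F1) (H2 : hermitianSpaceType F2).
Variables (sigma : {rmorphism F1 -> F2}) (phi : H1 -> H2).
Hypothesis phi_inj : injective phi.
Hypothesis phiD : {morph phi : u v / u + v}.
Hypothesis phiZ : forall a u, phi (a *: u) = sigma a *: phi u.
Hypothesis phi_perp : forall u v, hform u v = 0 -> hform (phi u) (phi v) = 0.
Hypothesis free2_ex : exists u v : H1, free2 u v.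

(** For nonzero [u], this is the solution of [hform (phi u) (phi u) = sigma (hform u u) * scale
    u]. *)
Let scale u := sigma (hform u u)^-1 * hform (phi u) (phi u).

Lemma hform_scale u v : u <> 0 ->
  hform (phi v) (phi u) = sigma (hform v u) * scale u.
Proof.
move=> u0; have /phi_perp e := hform_proj v u0.
rewrite -{1}(subrK (hproj u v) v) phiD hformDl e.
by rewrite add0r phiZ hformZl rmorphM -mulrA.
Qed.

Lemma scaleD u v : free2 u v -> scale (u + v) = scale v.
Proof.
move=> fuv; have u0 := free2_neq0 fuv; have v0 := free2_neq0 (free2C fuv).
have uv0 : u + v <> 0.
  move=> e; have [] := fuv 1 1; first by rewrite !scale1r.
  by move/eqP; rewrite oner_eq0.
(* [w] is orthogonal to [u] but, by anisotropy, not to [v]. Pairing [phi w] with [phi (u + v)] thus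
   relates the factors of [u + v] and [v] alone. *)
set w := v - hproj u v; have wu : hform w u = 0 := hform_proj v u0.
have w0 : w <> 0.
  move=> /eqP; rewrite subr_eq0 => /eqP e.
  have [_ []] := (free2P _ _).1 fuv; rewrite e.
  exact/in_span2Z/in_span2l.
have wv : sigma (hform w v) != 0.
  apply: rmorph_sfield_neq0; apply/eqP => /hformC0 vw; apply: w0.
  apply: hform_anisotropic; rewrite {1}/w hformBl vw /hproj hformZl.
  by rewrite ((hformC0 u w).2 wu) mulr0 subrr.
have := hform_scale w uv0; rewrite (phiD u) hformDr !hform_scale //.
rewrite hformDr wu rmorph0 mul0r !add0r => e.
by rewrite -[LHS]mul1r -(sfield_mulVr wv) -mulrA -e mulrA sfield_mulVr // mul1r.
Qed.

(** Independent vectors share the factor of their sum; dependent ones are compared through a fixed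
    free pair. *)
Lemma scale_const : exists l, forall u, u <> 0 -> scale u = l.
Proof.
have free_const p q : free2 p q -> scale p = scale q.
  by move=> fpq; rewrite -(scaleD fpq) addrC (scaleD (free2C fpq)).
have [e [w few]] := free2_ex; exists (scale e) => u u0.
have [/free_const//|/free_const <-] := free2_or few u0.
exact/esym/free_const.
Qed.

Lemma hform_semilinear : exists2 lambda : F2, lambda != 0 &
  forall u v, hform (phi u) (phi v) = sigma (hform u v) * lambda.
Proof.
have phi0 : phi 0 = 0 by apply: (addrI (phi 0)); rewrite -phiD !addr0.
have [l hl] := scale_const; exists l => [|u v].
  have [e [w few]] := free2_ex; have e0 := free2_neq0 few.
  have pe0 : phi e <> 0 by rewrite -phi0 => /phi_inj.
  rewrite -(hl _ e0) /scale sfield_mulf_neq0 ?hform_neq0 //.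
  by apply: rmorph_sfield_neq0; rewrite sfield_invr_neq0 ?hform_neq0.
(* The factor is known to be [l] only at nonzero vectors; for [v = 0] both sides vanish. *)
have [->|/eqP v0] := eqVneq v 0; last by rewrite -(hl _ v0) hform_scale.
have h0 (F : starSfieldType) (H : hermitianSpaceType F) (x : H) : hform x 0 = 0.
  by apply/hformC0; rewrite -(scale0r 0) hformZl mul0r.
by rewrite phi0 !h0 rmorph0 mul0r.
Qed.

End Quasiunitary.

Theorem theorem4p7 (F1 F2 : starSfieldType)
    (H1 : hermitianSpaceType F1) (H2 : hermitianSpaceType F2)
    (count1 : countably_orthogonal H1) (count2 : countably_orthogonal H2)
    (dim1 : dim_ge 3 H1) (dim2 : dim_ge 3 H2)
    (f : projective H1 -> projective H2) (f_ortho : orthoisomorphism f) :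
  exists phi : H1 -> H2,
    quasiunitary phi /\ forall u : H1, f (pline u) = pline (phi u).
Proof.
have [[f' fK f'K] f_perp] := f_ortho.
(* [g u] is an arbitrary generator of the line [f (pline u)]. *)
have /choice[g fg] u := pline_surj (f (pline u)).
have g_perp u v : hform u v = 0%R <-> hform (g u) (g v) = 0%R.
  rewrite -!pperp_pline -!fg; exact: f_perp.
have g0 : g 0%R = 0%R.
  by apply: hform_anisotropic; apply/g_perp; rewrite -(scale0r 0) hformZl mul0r.
have g_surj y : exists u (a : F2), a != 0%R /\ y = (a *: g u)%R.
  have [->|/eqP y0] := eqVneq y 0%R.
    by exists 0%R, 1%R; rewrite oner_eq0 g0 scaler0.
  (* [u] generates the line that [f] sends to the line of [y]. *)
  have [u eu] := pline_surj (f' (pline y)).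
  have /pline_eq[a ey] : pline (g u) = pline y by rewrite -fg -eu f'K.
  exists u, a; split=> //; apply/eqP => a0; apply: y0.
  by rewrite ey a0 scale0r.
have g_span2 u v w : in_span2 u v w <-> in_span2 (g u) (g v) (g w).
  (* Span membership becomes a condition on orthogonal vectors. Every test vector [y] is a nonzero
     multiple of some [g x], so the conditions on both sides correspond. *)
  rewrite !in_span2_perp; split=> [h y|h x].
    have [x [a [a0 ->]]] := g_surj y.
    have perpZ z : hform (g z) (a *: g x)%R = 0%R <-> hform z x = 0%R.
      rewrite g_perp (hformC0 (g z) (g x)) hformC0 hformZl; split=> [e|->].
        by apply/eqP/negPn/negP => n0; move/eqP: e; apply/negP/sfield_mulf_neq0.
      by rewrite mulr0.
    by rewrite !perpZ; exact: h.
  by rewrite !g_perp; exact: h.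
have free3_ex u v := @dim_ge3_free3 _ _ u v dim1.
have free2_ex : exists u v : H1, free2 u v.
  have [u [v [w fuvw]]] := (dim_ge3P H1).1 dim1.
  by exists u, v; exact: free3_free2 fuvw.
have [phi [sigma [bij_phi bij_sigma phiD phiZ phig]]] :=
  fundamental_projective_geometry g0 g_span2 g_surj free3_ex free2_ex.
exists phi; split; last first.
  by move=> u; have [a a0 ->] := phig u; rewrite pline_scale.
split=> //; exists sigma; split; first by split.
apply: hform_semilinear => //; first exact: bij_inj.
(* Orthogonality passes from [g] to [phi], whose values are multiples of those of [g]. *)
move=> u v /g_perp guv; have [a _ ->] := phig u; have [b _ ->] := phig v.
rewrite hformZl; suff -> : hform (g u) (b *: g v)%R = 0%R by rewrite mulr0.
by apply/hformC0; rewrite hformZl ((hformC0 _ (g u)).2 guv) mulr0.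
Qed.
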